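(* The family of forest polynomials $\{\mathfrak{P}_F: F\in\mathsf{For}\}$ in $\mathrm{Pol}$ is uniquely characterized by the following properties: $\mathfrak{P}_\varnothing=1$; each $\mathfrak{P}_F$ is homogeneous; and for all $F\in\mathsf{For}$ and $i\ge 1$, $\mathsf{T}_i\mathfrak{P}_F=\mathfrak{P}_{F/i}$ if $i\in \mathrm{LTer}(F)$ and $\mathsf{T}_i\mathfrak{P}_F=0$ otherwise. (That is, the forest polynomials satisfy these properties, and any family $\{H_F:F\in\mathsf{For}\}\subset\mathrm{Pol}$ satisfying the same properties has $H_F=\mathfrak{P}_F$ for all $F$.)
   Context: $\mathbb{N}=\{1,2,\ldots\}$ and $\mathrm{Pol}=\mathbb{Z}[x_1,x_2,\ldots]$. For $i\ge 1$, $\mathsf{R}_i(f)=f(x_1,\ldots,x_{i-1},0,x_i,x_{i+1},\ldots)$ and $\mathsf{T}_i(f)=\frac{\mathsf{R}_{i+1}(f)-\mathsf{R}_i(f)}{x_i}$ for $f\in\mathrm{Pol}$. Forests: a binary tree is a finite rooted plane tree in which each node is either a leaf (no children) or internal, having an ordered pair of children $v_L,v_R$; $\ast$ is the tree with a single node (a leaf). An indexed forest is an infinite sequence $F=(T_1,T_2,\ldots)$ of binary trees, all but finitely many equal to $\ast$; $\mathsf{For}$ is the set of indexed forests, and $\varnothing$ is the forest all of whose trees are $\ast$. The leaves of $F$, read from left to right through $T_1,T_2,\ldots$, are identified with $1,2,3,\ldots$. $\mathrm{IN}(F)$ is the finite set of internal nodes. For $v\in \mathrm{IN}(F)$, $\rho_F(v)\in\mathbb{N}$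 is the leaf reached from $v$ by repeatedly passing to the left child. A node $v\in\mathrm{IN}(F)$ is terminal if both its children are leaves, and $\mathrm{LTer}(F)=\{\rho_F(v): v\text{ terminal}\}$. If $i\in \mathrm{LTer}(F)$, the trimmed forest $F/i$ is obtained by deleting the two leaf children of the terminal node $v$ with $\rho_F(v)=i$, so that $v$ becomes a leaf (leaves are then relabelled from left to right). Forest polynomials: let $\mathcal{C}(F)$ be the set of $\kappa:\mathrm{IN}(F)\to\mathbb{N}$ such that for all $v\in \mathrm{IN}(F)$: $\kappa(v)\le\rho_F(v)$; if $v_L\in \mathrm{IN}(F)$ then $\kappa(v)\le\kappa(v_L)$; if $v_R\in \mathrm{IN}(F)$ then $\kappa(v)<\kappa(v_R)$. Then $\mathfrak{P}_F=\sum_{\kappa\in\mathcal{C}(F)}\prod_{v\in \mathrm{IN}(F)}x_{\kappa(v)}$. *)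

(* Defs.v *)
From HB Require Import structures.
From mathcomp Require Import all_boot all_algebra.
From mathcomp Require Import finmap.
From mathcomp.multinomials Require Import monalg.

Set Implicit Arguments.
Unset Strict Implicit.
Unset Printing Implicit Defensive.

Import GRing.Theory.
Local Open Scope fset_scope.
Local Open Scope ring_scope.

(* The positive integers are encoded by [nat] through k |-> k - 1, uniformly:  *)
(* variables, leaves, values of colorings  and indices of R_i and T_i all      *)
(* start at 0. The formulas below only compare, increment and decrement        *)
(* indices, so they are the same in both numberings.                           *)

Definition Pol := {malg int[{cmonom nat}]}.
HB.instance Definition _ := GRing.ComNzRing.on Pol.

Definition x_ (i : nat) : Pol := << ucm i >>.

Definition homogeneous (f : Pol) : Prop :=
  exists d : nat, forall m, m \in msupp f -> mdeg m = d.

Definition subst_monom (s : nat -> Pol) (m : {cmonom nat}) : Pol :=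
  \prod_(j <- finsupp m) s j ^+ m j.

Lemma subst_monomEw (s : nat -> Pol) (m : {cmonom nat}) (d : {fset nat}) :
  finsupp m `<=` d -> subst_monom s m = \prod_(j <- d) s j ^+ m j.
Proof.
move=> le; rewrite /subst_monom; apply: (big_fset_incl _ le) => j jd jm.
by rewrite fsfun_dflt // expr0.
Qed.

Lemma subst_monom_mmorphism (s : nat -> Pol) : mmorphism (subst_monom s).
Proof.
split=> [m1 m2|]; last by rewrite /subst_monom mdom1 big_seq_fset0.
rewrite /subst_monom mdomD.
rewrite -!/(subst_monom s _).
rewrite (subst_monomEw _ (fsubsetUl (finsupp m1) (finsupp m2))).
rewrite (subst_monomEw _ (fsubsetUr (finsupp m1) (finsupp m2))) -big_split /=.
by apply: eq_bigr => j _; rewrite cmM exprD.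
Qed.

HB.instance Definition _ s :=
  isMultiplicative.Build {cmonom nat} Pol (subst_monom s)
    (subst_monom_mmorphism s).

(* The ring endomorphism of Pol sending x_j to s j.                            *)
Definition subst (s : nat -> Pol) : Pol -> Pol :=
  mmap (@malgC {cmonom nat} int) (subst_monom s).

HB.instance Definition _ s := GRing.RMorphism.on (subst s).

Lemma subst_x s j : subst s (x_ j) = s j.
Proof.
by rewrite /subst /x_ mmapU /= mpolyC1E mul1r /subst_monom mdomU big_seq_fset1
  cmUU expr1.
Qed.

Definition R_ (i : nat) : Pol -> Pol :=
  subst (fun j => if (j < i)%N then x_ j else if j == i then 0 else x_ j.-1).

(* The quotient of f by x_i: the terms of f containing x_i, divided by x_i.    *)
(* It is exact when x_i divides f, as in the definition of T_ (lemma T_E).     *)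
Definition divx (i : nat) (f : Pol) : Pol :=
  \sum_(m <- msupp f | (0 < m i)%N) << f@_m *g divcm m (ucm i) >>.

Definition T_ (i : nat) (f : Pol) : Pol := divx i (R_ i.+1 f - R_ i f).
(* Check (fun s => subst s : {rmorphism Pol -> Pol}). *)

Lemma substE s f :
  subst s f = \sum_(m <- msupp f) (f@_m)%:MP * subst_monom s m.
Proof. by []. Qed.

Lemma eq_subst s t f : s =1 t -> subst s f = subst t f.
Proof.
move=> st; rewrite (substE s) (substE t); apply: eq_bigr => m _.
apply: (congr1 (fun u => _ * u)); rewrite /subst_monom.
by apply: eq_bigr => j _; rewrite st.
Qed.

Lemma subst_comp s t f : subst s (subst t f) = subst (fun j => subst s (t j)) f.
Proof.
rewrite [RHS]substE (substE t) rmorph_sum /=.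
apply: eq_bigr => m _; rewrite rmorphM /=; congr (_ * _).
  by rewrite /subst mmapC.
rewrite /subst_monom rmorph_prod /=; apply: eq_bigr => j _.
by rewrite rmorphXn.
Qed.

Lemma malgMU (m1 m2 : {cmonom nat}) :
  << mulcm m1 m2 >> = << m1 >> * << m2 >> :> Pol.
Proof. by rewrite malgM_def fgmulUU mul1r. Qed.

Lemma monomE (m : {cmonom nat}) : << m >> = subst_monom x_ m.
Proof.
pose pw j n : {cmonom nat} := mkcmonom [fsfun i in [fset j] => n | 0%N].
have pwE j n i : pw j n i = if i == j then n else 0%N.
  by rewrite cmE fsfun_fun in_fset1.
have xn j n : x_ j ^+ n = << pw j n >>.
  elim: n => [|n IH].
    have -> : pw j 0%N = mone.
      by apply/eqP/cmP => i; rewrite pwE cm1 if_same.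
    by rewrite expr0 -[LHS]mpolyC1E.
  rewrite exprS IH /x_ -malgMU; apply: (congr1 (fun k => mkmalgU k _)); apply/eqP/cmP => i.
  by rewrite cmM cmU !pwE eq_sym; case: eqP.
rewrite /subst_monom; under eq_bigr do rewrite xn.
rewrite -(big_morph (fun k : {cmonom nat} => << k >> : Pol) malgMU
  (mpolyC1E _ _)).
apply: (congr1 (fun k => mkmalgU k _)); apply/eqP/cmP => i.
rewrite (big_morph (fun k : {cmonom nat} => k i) (cmM i) (cm1 i)).
under eq_bigr do rewrite pwE.
have [im|im] := boolP (i \in finsupp m).
  rewrite (big_fsetD1 i) //= eqxx big_seq big1 ?addn0 // => j.
  by rewrite in_fsetD1 eq_sym => /andP[/negPf ->].
rewrite big_seq big1 => [|j jm]; first by apply/eqP; rewrite cmE_eq0.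
by case: eqP => // ij; rewrite ij jm in im.
Qed.

Lemma divxE i f :
  f = x_ i * divx i f + subst (fun j => if j == i then 0 else x_ j) f.
Proof.
rewrite {1}(monalgE f) {1}/divx mulr_sumr substE.
rewrite [X in _ = X + _]big_mkcond -big_split /=; apply: eq_bigr => m _.
have Cm c : << c *g m >> = c%:MP * << m >> :> Pol.
  by rewrite malgM_def fgmulUU mulr1 mul1m.
case: ifPn => [mi|]; last first.
  rewrite -eqn0Ngt cmE_eq0 => mi; rewrite add0r Cm; congr (_ * _).
  rewrite monomE /subst_monom; apply: eq_big_seq => j jm.
  by have /negPf -> : j != i by apply: contraNneq mi => <-.
rewrite [X in _ + X](_ : _ = 0) ?addr0; last first.
  rewrite /subst_monom (big_fsetD1 i) -?cmE_neq0 -?lt0n //= eqxx expr0n.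
  by rewrite eqn0Ngt mi mul0r mulr0.
rewrite /x_ malgM_def fgmulUU mul1r; apply: (congr1 (fun k => mkmalgU k _)); apply/eqP/cmP => j.
rewrite cmM divcmE cmU; case: eqP => [<-|]; last by rewrite add0n subn0.
by rewrite addnC subnK.
Qed.

Lemma T_E i f : x_ i * T_ i f = R_ i.+1 f - R_ i f.
Proof.
rewrite [RHS](divxE i) -/(T_ i f).
pose k j : Pol := if j == i then 0 else x_ j.
suff kR : subst k (R_ i.+1 f) = subst k (R_ i f).
  have kB g h : subst k (g - h) = subst k g - subst k h by exact: rmorphB.
  have kD : subst k (R_ i.+1 f - R_ i f) = 0.
    by rewrite kB; apply/eqP; rewrite subr_eq0; apply/eqP.
  by rewrite -[LHS]addr0 -[in LHS]kD.
rewrite /R_ [LHS]subst_comp [RHS]subst_comp; apply: eq_subst => j.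
have k0 : subst k 0 = 0 by exact: rmorph0.
rewrite ltnS; case: (ltngtP j i) => [ji|ij|->].
- by [].
- have [->|_] := eqVneq j i.+1; last by [].
  by rewrite k0 subst_x /k eqxx.
- by rewrite k0 subst_x /k eqxx.
Qed.

Inductive bintree := Leaf | Node of bintree & bintree.

Fixpoint eq_bintree (t u : bintree) : bool :=
  match t, u with
  | Leaf, Leaf => true
  | Node l r, Node l' r' => eq_bintree l l' && eq_bintree r r'
  | _, _ => false
  end.

Lemma eq_bintreeP : Equality.axiom eq_bintree.
Proof.
elim=> [|l IHl r IHr] [|l' r'] /=; try by constructor.
apply: (iffP andP) => [[/IHl -> /IHr ->] //|[<- <-]].
by split; [apply/IHl | apply/IHr].
Qed.

HB.instance Definition _ := hasDecEq.Build bintree eq_bintreeP.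

(* A node of a tree is addressed by the path to it from the root, where false  *)
(* goes to the left child and true to the right child. Both enumerations below *)
(* are free of repetitions, and the leaves come from left to right.            *)
Fixpoint internals (t : bintree) : seq (seq bool) :=
  if t is Node l r
  then [::] :: map (cons false) (internals l) ++ map (cons true) (internals r)
  else [::].

Fixpoint leaves (t : bintree) : seq (seq bool) :=
  if t is Node l r
  then map (cons false) (leaves l) ++ map (cons true) (leaves r)
  else [:: [::]].

Fixpoint subtree (t : bintree) (p : seq bool) : bintree :=
  match p, t with
  | [::], _ => t
  | b :: p', Node l r => subtree (if b then r else l) p'
  | _ :: _, Leaf => Leaf
  end.

(* Path from the root to the leaf reached by always going left.                *)
Fixpoint left_path (t : bintree) : seq bool :=
  if t is Node l _ then false :: left_path l else [::].

(* t with its subtree at p replaced by a leaf.                                 *)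
Fixpoint prune (t : bintree) (p : seq bool) : bintree :=
  match p, t with
  | [::], _ => Leaf
  | false :: p', Node l r => Node (prune l p') r
  | true :: p', Node l r => Node l (prune r p')
  | _ :: _, Leaf => Leaf
  end.

Definition forest := {fsfun nat -> bintree with Leaf}.

Definition empty_forest : forest := [fsfun].

(* The node (k, p) of a forest is the node at address p of its k-th tree.      *)
Notation node := (nat * seq bool)%type.

Definition lchild (v : node) : node := (v.1, rcons v.2 false).
Definition rchild (v : node) : node := (v.1, rcons v.2 true).

Definition IN (F : forest) : {fset node} :=
  [fset ((k, p) : node) | k in finsupp F, p in internals (F k)].

Lemma mem_IN F (v : node) : (v \in IN F) = (v.2 \in internals (F v.1)).
Proof.
case: v => k p /=; apply/imfset2P/idP => /=.
  by move=> [j jF] [q qj] [-> ->].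
move=> pk; exists k; last by exists p.
by case: (finsuppP F k) pk => // _; rewrite in_nil.
Qed.

Definition is_leaf (F : forest) (v : node) : bool := v.2 \in leaves (F v.1).

(* The rank of the leaf v among all the leaves of F, read from left to right.  *)
Definition leaf_label (F : forest) (v : node) : nat :=
  (\sum_(j < v.1) size (leaves (F j)) + index v.2 (leaves (F v.1)))%N.

Definition rho (F : forest) (v : node) : nat :=
  leaf_label F (v.1, v.2 ++ left_path (subtree (F v.1) v.2)).

Definition terminal (F : forest) (v : node) : bool :=
  [&& v \in IN F, is_leaf F (lchild v) & is_leaf F (rchild v)].

Definition LTer (F : forest) : {fset nat} :=
  [fset rho F v | v in IN F & terminal F v].

(* F/i; rho is injective on terminal nodes, so [pick] has at most one choice.  *)
(* The value when i is not in LTer F is irrelevant.                            *)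
Definition trim (F : forest) (i : nat) : forest :=
  if [pick v : IN F | terminal F (val v) && (rho F (val v) == i)] is Some v
  then [fsfun F with (val v).1 |-> prune (F (val v).1) (val v).2]
  else F.

Definition coloring (F : forest) (kappa : IN F -> nat) : bool :=
  [forall v : IN F,
    [&& (kappa v <= rho F (val v))%N,
        [forall w : IN F, (val w == lchild (val v)) ==> (kappa v <= kappa w)%N]
      & [forall w : IN F, (val w == rchild (val v)) ==> (kappa v < kappa w)%N]]].

(* Every coloring takes its values below this bound (lemma coloring_lt), so    *)
(* the sum defining the forest polynomial runs over all colorings.             *)
Definition color_bound (F : forest) : nat := (\max_(v : IN F) rho F (val v)).+1.

Lemma coloring_lt (F : forest) (kappa : IN F -> nat) (v : IN F) :
  coloring kappa -> (kappa v < color_bound F)%N.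
Proof.
move=> /forallP/(_ v)/and3P[kv _ _]; rewrite ltnS (leq_trans kv) //.
exact: (leq_bigmax v).
Qed.

Definition forest_poly (F : forest) : Pol :=
  \sum_(kappa : {ffun IN F -> 'I_(color_bound F)} | coloring (fun v => kappa v))
    \prod_(v : IN F) x_ (kappa v).

Definition characterization (H : forest -> Pol) : Prop :=
  [/\ H empty_forest = 1,
      forall F, homogeneous (H F)
    & forall F i, T_ i (H F) = if i \in LTer F then H (trim F i) else 0].

(* Main.v *)
From mathcomp Require Import all_boot all_algebra.
From mathcomp Require Import finmap zify.
From mathcomp.multinomials Require Import monalg.
From Stdlib Require Import FunctionalExtensionality.
Require Import Defs.

Set Implicit Arguments.
Unset Strict Implicit.
Unset Printing Implicit Defensive.

Import GRing.Theory.
Local Open Scope fset_scope.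
Local Open Scope ring_scope.

(** Why the theorem is true.

    Uniqueness.  If every T_i kills f, then all R_i f are equal; for large i
    the substitution R_i does not touch the variables of f, so f = R_0 f, and
    iterating R_0 sends every variable of f to 0: f is constant
    ([T_eq0_const]).  Two families with the listed properties therefore agree
    at F up to a constant as soon as they agree at all trimmings of F, and
    trimming removes an internal node.  The constant vanishes: a nonempty F
    has some i in LTer F, and T_i H_F = P_(F/i) is not zero, so H_F, being
    homogeneous and not constant, has constant term 0 ([at0_eq0]); so has P_F.

    Existence.  R_i acts on a sum over colorings by discarding the colorings
    that use the color i and closing the gap.  The resulting colorings satisfy
    the same inequalities between parents and children, and only the bound at
    each leaf moves: it becomes [bound i].  The bounds [bound i.+1] and
    [bound i] differ at the leaf i alone, so R_(i+1) P_F - R_i P_F counts the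
    colorings in which the lowest node v with rho v = i takes the color i; it
    is 0 if there is no such v.  If v is terminal, removing it leaves the
    colorings of F/i ([tree_diff_cherry]); if v has an internal right child w,
    then rho w = i + 1 leaves no color for w, and the difference is 0
    ([tree_diff_no_cherry]).

    The argument runs by induction on trees, on a recursive form [tree_poly]
    of the generating function in which the color of the root is summed first.
    P_F is the product of these over the trees of F ([sum_colorings]); a sum
    over functions on the nodes is compared to it by summing over the value at
    one node after the other ([isum]).

    The combinatorial part is carried out in an arbitrary commutative ring A
    with a sequence x of elements, in place of Pol and its variables. *)

(** * Variables, substitutions and constants *)

(** Multiplication by a variable shifts the coefficients, so it loses
    nothing. *)
Lemma x_inj i : injective (fun f : Pol => x_ i * f).
Proof.
have coef (f : Pol) m : (x_ i * f)@_(mulcm (ucm i) m) = f@_m.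
  have le1 : msupp (x_ i) `<=` [fset ucm i] by exact: msuppU_le.
  rewrite (mcoeffMlw _ le1 (fsubset_refl _)) big_seq_fset1.
  have cancel_ucm k : (mulcm (ucm i) k == mulcm (ucm i) m) = (k == m).
    apply/eqP/eqP => [km|-> //]; apply/eqP/cmP => j.
    by have := congr1 (fun c : {cmonom nat} => c j) km;
    rewrite !mulcmE => /addnI.
  under eq_bigr => k _ do rewrite mcoeffUU mul1r cancel_ucm.
  have [mf|mf] := boolP (m \in msupp f); last first.
    rewrite (mcoeff_outdom mf) big1_fset // => k kf _.
    by have /negPf -> : k != m by apply: contraNneq mf => <-.
  rewrite (big_fsetD1 m) //= eqxx big1_fset => [|k]; first exact: addr0.
  by rewrite in_fsetD1 => /andP[/negPf -> _] _.
by move=> f g fg; apply/malgP => m; rewrite -(coef f) -(coef g) fg.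
Qed.

(** The defining equation of T_i characterizes it, so divided differences are
    computed without unfolding the division. *)
Lemma T_eq i f g : R_ i.+1 f - R_ i f = x_ i * g -> T_ i f = g.
Proof. by rewrite -T_E => /x_inj. Qed.

Lemma T_eq0 i f : R_ i.+1 f = R_ i f -> T_ i f = 0.
Proof. by move=> RR; apply: T_eq; rewrite RR subrr mulr0. Qed.

Lemma R_0 i : R_ i 0 = 0. Proof. exact: rmorph0. Qed.
Lemma R_B i : {morph R_ i : f g / f - g}. Proof. exact: rmorphB. Qed.

Lemma mulrB_cross (A : comNzRingType) (x f g a b c d : A) :
  x * f = a - b -> x * g = c - d -> (a - c) - (b - d) = x * (f - g).
Proof.
rewrite mulrBr => -> ->.
by rewrite !opprB addrACA [RHS]addrACA [- c + _]addrC.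
Qed.

Lemma T_B i (f g : Pol) : T_ i (f - g) = T_ i f - T_ i g.
Proof.
apply: T_eq; rewrite !R_B; exact: (mulrB_cross (T_E i f) (T_E i g)).
Qed.

Definition only_vars n (f : Pol) :=
  forall m, m \in msupp f -> forall j, j \in finsupp m -> (j < n)%N.

Lemma only_varsP f : exists n, only_vars n f.
Proof.
exists (\max_(m <- msupp f) \max_(j <- finsupp m) j).+1 => m mf j jm.
rewrite ltnS (leq_trans _ (leq_bigmax_seq _ mf _)) //.
exact: (leq_bigmax_seq _ jm).
Qed.

Lemma eq_subst_vars n f s t :
  only_vars n f -> (forall j, (j < n)%N -> s j = t j) -> subst s f = subst t f.
Proof.
move=> fn st; rewrite !substE; apply: eq_big_seq => m mf.
apply: (congr1 (fun u => _ * u)); rewrite /subst_monom.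
apply: eq_big_seq => j jm.
by rewrite st // (fn m mf).
Qed.

Lemma subst_id f : subst x_ f = f.
Proof.
rewrite substE [RHS]monalgE; apply: eq_bigr => m _.
by rewrite -monomE malgM_def fgmulUU mulr1 mul1m.
Qed.

Lemma R_large f : exists n, forall i, (n <= i)%N -> R_ i f = f.
Proof.
have [n fn] := only_varsP f; exists n => i ni.
rewrite -[RHS]subst_id; apply: (eq_subst_vars fn) => j jn.
by rewrite (leq_trans jn ni).
Qed.

Definition at0 : Pol -> Pol := subst (fun=> 0).

Lemma at0_B : {morph at0 : f g / f - g}. Proof. exact: rmorphB. Qed.

Lemma mul0_sub_eq (A : comNzRingType) (x t a b : A) :
  x * t = a - b -> t = 0 -> a = b.
Proof. by move=> xt t0; apply/eqP; rewrite -subr_eq0 -xt t0 mulr0. Qed.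

(** The common value of the R_i f is f, by taking i large.  The n-th iterate
    of R_0 kills the first n variables, and still fixes f; for n large all
    variables of f are among these. *)
Lemma T_eq0_const f : (forall i, T_ i f = 0) -> f = at0 f.
Proof.
move=> Tf; have Rf i : R_ i f = R_ 0 f.
  elim: i => [|i <-]; first by [].
  exact: (mul0_sub_eq (T_E i f) (Tf i)).
have R0f : R_ 0 f = f.
  by have [n fn] := R_large f; rewrite -(Rf n) fn.
have shift n : subst (fun j => if (j < n)%N then 0 else x_ (j - n)) f = f.
  elim: n => [|n IH].
    by rewrite -[RHS]subst_id; apply: eq_subst => j; rewrite subn0.
  rewrite -[RHS]IH -{2}R0f /R_ [RHS]subst_comp; apply: eq_subst => j.
  case: j => [|j] /=; first by rewrite [RHS]rmorph0.
  by rewrite subst_x ltnS subSS.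
have [n fn] := only_varsP f.
by rewrite -[LHS](shift n); apply: (eq_subst_vars fn) => j ->.
Qed.

Lemma at0_R i f : R_ i (at0 f) = at0 f.
Proof.
by rewrite [LHS]subst_comp; apply: eq_subst => j; rewrite [LHS]rmorph0.
Qed.

Lemma at0_homogeneous f : homogeneous f -> at0 f = 0 \/ at0 f = f.
Proof.
case=> [[|d] fd].
- right; rewrite [RHS]monalgE [LHS]substE.
  apply: eq_big_seq => m /fd /mdeg_eq0I ->.
  by rewrite mmorph1 mulr1.
- left; rewrite [LHS]substE big1_fset // => m /fd md _.
  have [j jm] : exists j, j \in finsupp m.
    apply/fset0Pn; apply: contra_eq_neq md => m0.
    by rewrite mdegE m0 big_seq_fset0.
  rewrite /subst_monom (big_fsetD1 j) //= expr0n cmE_eq0 jm.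
  by rewrite mul0r mulr0.
Qed.

(** Constants are killed by T_i, so f has positive degree. *)
Lemma at0_eq0 f i : homogeneous f -> T_ i f <> 0 -> at0 f = 0.
Proof.
case/at0_homogeneous => // ff; case; apply: T_eq0.
by rewrite -ff !at0_R.
Qed.

Lemma homogeneous_sum (I : Type) (r : seq I) (P : pred I) (E : I -> Pol) d :
  (forall i, P i -> forall m, m \in msupp (E i) -> mdeg m = d) ->
  homogeneous (\sum_(i <- r | P i) E i).
Proof.
move=> Ed; exists d; elim/big_ind: _ => [m|f g fd gd m|] //.
  by rewrite msupp0 in_fset0.
by move=> /(fsubsetP (msuppD_le _ _)); rewrite in_fsetU => /orP[/fd|/gd].
Qed.

Lemma mdeg_prod_x (I : Type) (r : seq I) (c : I -> nat) m :
  m \in msupp (\prod_(i <- r) x_ (c i)) -> mdeg m = size r.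
Proof.
have -> : \prod_(i <- r) x_ (c i) =
    << \big[mmul/mone]_(i <- r) ucm (c i) >> :> Pol.
  elim/big_rec2: _ => [|i m' f _ ->]; first by rewrite -[LHS]mpolyC1E.
  by rewrite -malgMU.
move=> /(fsubsetP msuppU_le); rewrite in_fset1 => /eqP ->.
rewrite mdeg_prod; under eq_bigr do rewrite mdegU.
by rewrite sum1_size.
Qed.

(** * Leaves and ranks *)

Definition nleaves (t : bintree) : nat := size (leaves t).

(** With rank counted inside its own tree, rho is the rank plus the number of
    leaves of the preceding trees ([rhoE]), which allows induction on trees. *)
Definition rank (t : bintree) (p : seq bool) : nat :=
  index (p ++ left_path (subtree t p)) (leaves t).

Lemma nleaves_Node l r : nleaves (Node l r) = (nleaves l + nleaves r)%N.
Proof. by rewrite /nleaves /= size_cat !size_map. Qed.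

Lemma nleaves_gt0 t : (0 < nleaves t)%N.
Proof. by elim: t => // l IHl r _; rewrite nleaves_Node addn_gt0 IHl. Qed.

Lemma cons_inj (b : bool) : injective (cons b). Proof. by move=> p q []. Qed.

Lemma mem_cons_false p (s s' : seq (seq bool)) :
  (false :: p \in map (cons false) s ++ map (cons true) s') = (p \in s).
Proof.
rewrite mem_cat (mem_map (@cons_inj false)) orbC.
by case: mapP => // -[q _ []].
Qed.

Lemma mem_cons_true p (s s' : seq (seq bool)) :
  (true :: p \in map (cons false) s ++ map (cons true) s') = (p \in s').
Proof.
rewrite mem_cat (mem_map (@cons_inj true)).
by case: mapP => // -[q _ []].
Qed.

Lemma index_cons_false p (s s' : seq (seq bool)) : p \in s ->
  index (false :: p) (map (cons false) s ++ map (cons true) s') = index p s.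
Proof.
move=> ps; rewrite index_cat (map_f (cons false) ps).
by rewrite (index_map (@cons_inj false)).
Qed.

Lemma index_cons_true p (s s' : seq (seq bool)) :
  index (true :: p) (map (cons false) s ++ map (cons true) s') =
  (size s + index p s')%N.
Proof.
rewrite index_cat size_map (index_map (@cons_inj true)).
by case: mapP => // -[q _ []].
Qed.

Lemma mem_internals_cons (b : bool) l r p :
  (b :: p \in internals (Node l r)) = (p \in internals (if b then r else l)).
Proof. by case: b; rewrite in_cons /= ?mem_cons_false ?mem_cons_true. Qed.

Lemma mem_leaves_cons (b : bool) l r p :
  (b :: p \in leaves (Node l r)) = (p \in leaves (if b then r else l)).
Proof. by case: b; rewrite /= ?mem_cons_false ?mem_cons_true. Qed.

Lemma index_left_path t : index (left_path t) (leaves t) = 0%N.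
Proof.
elim: t => // l IHl r _ /=; rewrite index_cons_false // -index_mem IHl.
exact: nleaves_gt0.
Qed.

Lemma left_path_mem t p :
  p \in internals t -> p ++ left_path (subtree t p) \in leaves t.
Proof.
elim: p t => [|b p IH] [|l r] //.
  by move=> _; rewrite -index_mem index_left_path; exact: nleaves_gt0.
by rewrite mem_internals_cons mem_leaves_cons => /IH; case: b.
Qed.

Lemma rank_root t : rank t [::] = 0%N.
Proof. by case: t => [|l r]; rewrite /rank index_left_path. Qed.

Lemma rank_left l r p :
  p \in internals l -> rank (Node l r) (false :: p) = rank l p.
Proof. by move=> pl; rewrite /rank /= index_cons_false // left_path_mem. Qed.

Lemma rank_right l r p : rank (Node l r) (true :: p) = (nleaves l + rank r p)%N.
Proof. by rewrite /rank /= index_cons_true. Qed.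

Lemma rank_lt t p : p \in internals t -> (rank t p < nleaves t)%N.
Proof. by move=> pt; rewrite index_mem left_path_mem. Qed.

(** Unlike the membership conditions on the two children ([cherryE]), this
    form of terminality reduces along a path. *)
Definition cherry (t : bintree) (p : seq bool) : bool :=
  subtree t p == Node Leaf Leaf.

Lemma cherry_internals t p : cherry t p -> p \in internals t.
Proof.
by elim: p t => [|b p IH] [|l r] //= /IH; rewrite -(mem_internals_cons b l r).
Qed.

Lemma cherryE t p :
  cherry t p = [&& p \in internals t, rcons p false \in leaves t
                 & rcons p true \in leaves t].
Proof.
elim: p t => [|b p IH] [|l r] //.
  rewrite /cherry /= mem_cons_false mem_cons_true.
  have nilE t : ([::] \in leaves t) = (t == Leaf).
    by case: t => //= l' r'; rewrite mem_cat; apply/orP => -[] /mapP[].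
  by rewrite !nilE.
by rewrite mem_internals_cons !rcons_cons !mem_leaves_cons -IH; case: b.
Qed.

Lemma exists_cherry t : t != Leaf -> exists p, cherry t p.
Proof.
elim: t => // l IHl r IHr _.
have [->|/IHl[p pl]] := eqVneq l Leaf; last by exists (false :: p).
have [->|/IHr[p pr]] := eqVneq r Leaf; last by exists (true :: p).
by exists [::].
Qed.

Lemma nleaves_prune t p : cherry t p -> nleaves t = (nleaves (prune t p)).+1.
Proof.
elim: p t => [[|l r] // /eqP[-> ->] //|b p IH [|l r] //=].
by case: b => /IH tp; rewrite !nleaves_Node tp ?addnS.
Qed.

Lemma internals_prune t p : p \in internals t ->
  {subset internals (prune t p) <= internals t} /\
  p \notin internals (prune t p).
Proof.
elim: p t => [[] //|b p IH [|l r] //].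
rewrite mem_internals_cons => /IH [sub pN]; split; last first.
  by case: b pN {IH sub} => pN; rewrite mem_internals_cons.
case: b sub {IH pN} => sub [|[] q] //;
  by rewrite !mem_internals_cons //; exact: sub.
Qed.

(** * The polynomial of a tree *)

Section TreePoly.
Variables (A : comNzRingType) (x : nat -> A).

(** The generating function of the colorings of t that use at least the color
    a at the root and stay strictly below b j at the nodes whose leftmost leaf
    is j, when the leaves of t are numbered from o on.  The color k of the
    root is the lower bound for the left child, k + 1 for the right child. *)
Fixpoint tree_poly (b : nat -> nat) (t : bintree) (o a : nat) : A :=
  if t is Node l r then
    \sum_(a <= k < b o)
      x k * tree_poly b l o k * tree_poly b r (o + nleaves l) k.+1
  else 1.

Lemma eq_tree_poly b b' t o a :
  (forall j, (o <= j < o + nleaves t)%N -> b j = b' j) ->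
  tree_poly b t o a = tree_poly b' t o a.
Proof.
elim: t o a => //= l IHl r IHr o a; rewrite nleaves_Node => bb.
have := nleaves_gt0 l => l0.
rewrite bb; last by lia.
apply: eq_bigr => k _; congr (_ * _ * _).
  by apply: IHl => j jl; apply: bb; lia.
by apply: IHr => j jl; apply: bb; lia.
Qed.

Lemma tree_poly_shift b t o a :
  tree_poly b t o.+1 a = tree_poly (fun j => b j.+1) t o a.
Proof.
elim: t o a => //= l IHl r IHr o a; apply: eq_bigr => k _.
by rewrite IHl addSn IHr.
Qed.

Lemma tree_poly_eq0 b t o a :
  t != Leaf -> (b o <= a)%N -> tree_poly b t o a = 0.
Proof. by case: t => //= l r _ ba; rewrite big_geq. Qed.

(** Closes the gap left by the color i.  Counting the colors below a that
    differ from i, it sends strict upper bounds to strict upper bounds. *)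
Definition squeeze (i a : nat) : nat := (a - (i < a))%N.

Lemma sum_squeeze i (g : nat -> A) a b :
  \sum_(a <= k < b) (if (k < i)%N then g k else if k == i then 0 else g k.-1) =
  \sum_(squeeze i a <= k < squeeze i b) g k.
Proof.
have sq m n : (m <= n)%N -> (squeeze i m <= squeeze i n)%N.
  by rewrite /squeeze; lia.
have [ab|ba] := leqP a b; last by rewrite !big_geq ?sq // ltnW.
elim: b ab => [|b IH]; first by rewrite leqn0 => /eqP ->; rewrite !big_geq.
rewrite leq_eqVlt => /predU1P[->|]; first by rewrite !big_geq.
rewrite ltnS => ab; rewrite big_nat_recr //= IH //.
case: ltngtP => bi.
- have -> : squeeze i b.+1 = (squeeze i b).+1 by rewrite /squeeze; lia.
  rewrite big_nat_recr ?sq //=.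
  by have -> : squeeze i b = b by rewrite /squeeze; lia.
- have -> : squeeze i b.+1 = (squeeze i b).+1 by rewrite /squeeze; lia.
  rewrite big_nat_recr ?sq //=.
  by have -> : squeeze i b = b.-1 by rewrite /squeeze; lia.
- rewrite addr0.
  by have -> : squeeze i b.+1 = squeeze i b by rewrite /squeeze; lia.
Qed.

(** A coloring that uses the color i is sent to 0, the others are renamed by
    [squeeze i], which is increasing on them and so preserves the inequalities
    between parents and children. *)
Lemma tree_poly_R i (f : {rmorphism A -> A}) b t o a :
  (forall j, f (x j) =
     if (j < i)%N then x j else if j == i then 0 else x j.-1) ->
  f (tree_poly b t o a) =
  tree_poly (fun j => squeeze i (b j)) t o (squeeze i a).
Proof.
move=> fx; elim: t o a => [|l IHl r IHr] o a /=; first exact: rmorph1.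
rewrite rmorph_sum /= -sum_squeeze; apply: eq_bigr => k _.
rewrite !rmorphM /= IHl IHr fx; case: ltngtP => ki; last by rewrite !mul0r.
  by congr (_ * tree_poly _ _ _ _ * tree_poly _ _ _ _); rewrite /squeeze; lia.
by congr (_ * tree_poly _ _ _ _ * tree_poly _ _ _ _); rewrite /squeeze; lia.
Qed.

(** The bound j + 1 of the forest polynomials after R_i: it is j + 1 for
    j < i and j for i <= j. *)
Definition bound (i j : nat) : nat := squeeze i j.+1.

Definition tree_diff i t o a :=
  tree_poly (bound i.+1) t o a - tree_poly (bound i) t o a.

Lemma bound_eq i j : i <> j -> bound i.+1 j = bound i j.
Proof. by rewrite /bound /squeeze; lia. Qed.

Lemma tree_poly_out i t o a : ~~ (o <= i < o + nleaves t)%N ->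
  tree_poly (bound i.+1) t o a = tree_poly (bound i) t o a.
Proof. by move=> oi; apply: eq_tree_poly => j jt; apply: bound_eq; lia. Qed.

Lemma tree_poly_before i t o a : (o + nleaves t <= i)%N ->
  tree_poly (bound i) t o a = tree_poly succn t o a.
Proof.
by move=> oi; apply: eq_tree_poly => j jt; rewrite /bound /squeeze; lia.
Qed.

(** The leaves after i lose one color under R_(i+1), and their labels drop
    by one when the leaves i and i + 1 are merged. *)
Lemma tree_poly_after i t o a : (i <= o)%N ->
  tree_poly (bound i.+1) t o.+1 a = tree_poly succn t o a.
Proof.
move=> oi; rewrite tree_poly_shift; apply: eq_tree_poly => j jt.
by rewrite /bound /squeeze; lia.
Qed.

Lemma tree_diff_out i t o a :
  ~~ (o <= i < o + nleaves t)%N -> tree_diff i t o a = 0.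
Proof. by move=> oi; rewrite /tree_diff tree_poly_out // subrr. Qed.

(** The strict bound on the root color is o + 1 in both terms, except when
    i = o, where it is o in the subtracted term.  The missing color o
    may be added, because it leaves no color for the left child, which shares
    the leaf o with the root. *)
Lemma tree_diff_left i l r o a : l != Leaf -> (o <= i < o + nleaves l)%N ->
  tree_diff i (Node l r) o a =
  \sum_(a <= k < o.+1)
    x k * tree_diff i l o k * tree_poly (bound i.+1) r (o + nleaves l) k.+1.
Proof.
move=> lN il; rewrite /tree_diff /=.
have -> : bound i.+1 o = o.+1 by rewrite /bound /squeeze; lia.
have -> : \sum_(a <= k < bound i o) x k * tree_poly (bound i) l o k *
    tree_poly (bound i) r (o + nleaves l) k.+1 =
  \sum_(a <= k < o.+1) x k * tree_poly (bound i) l o k *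
    tree_poly (bound i) r (o + nleaves l) k.+1.
  have [oi|oi] := ltnP o i.
    by have -> : bound i o = o.+1 by rewrite /bound /squeeze; lia.
  have bo : bound i o = o by rewrite /bound /squeeze; lia.
  rewrite bo; have [ao|oa] := leqP a o; last by rewrite !big_geq // ltnW.
  by rewrite [RHS]big_nat_recr //= tree_poly_eq0 ?bo // mulr0 mul0r addr0.
rewrite -sumrB; apply: eq_bigr => k _.
by rewrite -(@tree_poly_out i r) -?mulrBl -?mulrBr //; lia.
Qed.

Lemma tree_diff_right i l r o a : (o + nleaves l <= i)%N ->
  tree_diff i (Node l r) o a =
  \sum_(a <= k < o.+1)
    x k * tree_poly succn l o k * tree_diff i r (o + nleaves l) k.+1.
Proof.
move=> il; have l0 := nleaves_gt0 l; rewrite /tree_diff /=.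
have -> : bound i.+1 o = o.+1 by rewrite /bound /squeeze; lia.
have -> : bound i o = o.+1 by rewrite /bound /squeeze; lia.
rewrite -sumrB; apply: eq_bigr => k _.
by rewrite !(@tree_poly_before _ l) ?mulrBr //; lia.
Qed.

(** Here the root is the lowest node with leftmost leaf o, and only its color
    o survives in the difference; an internal right child would need a color
    between o + 1 and its strict bound o + 1. *)
Lemma tree_diff_leaf r o a : (a <= o)%N ->
  tree_diff o (Node Leaf r) o a = x o * (r == Leaf)%:R.
Proof.
move=> ao; rewrite /tree_diff /=.
have -> : bound o.+1 o = o.+1 by rewrite /bound /squeeze; lia.
have -> : bound o o = o by rewrite /bound /squeeze; lia.
rewrite big_nat_recr //= [X in _ + X - _]mulrAC mulr1 addrAC.
have -> : \sum_(a <= k < o) x k * 1 *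
      tree_poly (bound o.+1) r (o + nleaves Leaf) k.+1 =
    \sum_(a <= k < o) x k * 1 *
      tree_poly (bound o) r (o + nleaves Leaf) k.+1.
  by apply: eq_bigr => k _; rewrite tree_poly_out // /nleaves /=; lia.
rewrite subrr add0r; congr (_ * _).
case: eqVneq => [->//|rN]; apply: tree_poly_eq0 => //.
by rewrite /bound /squeeze /nleaves /=; lia.
Qed.

(** The cherry takes the color i, which is compatible with every coloring of
    the rest: the ancestors that are tied to it have colors at most i, with
    strict inequality past a right edge.  If the cherry is the root of t, the
    hypothesis a <= i makes the color i available to it. *)
Lemma tree_diff_cherry i t p o a : cherry t p -> (o + rank t p)%N = i ->
  (a <= i)%N -> tree_diff i t o a = x i * tree_poly succn (prune t p) o a.
Proof.
elim: p t o a => [|b p IH] [|l r] o a //.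
  by move=> /eqP[-> ->]; rewrite rank_root addn0 => -> /tree_diff_leaf ->.
case: b => [] /= tp.
  have {}tp : cherry r p := tp.
  rewrite rank_right addnA => rk ai.
  rewrite tree_diff_right -?rk ?leq_addr // rk.
  rewrite mulr_sumr; apply: eq_big_nat => k ko.
  have := nleaves_gt0 l => l0.
  by rewrite IH //; [rewrite mulrCA !mulrA|lia].
have {}tp : cherry l p := tp.
have pl := cherry_internals tp; have rl := rank_lt pl.
rewrite rank_left // => rk ai; rewrite tree_diff_left; last 2 first.
- by apply: contraTneq pl => ->.
- by lia.
rewrite mulr_sumr; apply: eq_big_nat => k ko.
rewrite IH //; last by lia.
have lE := nleaves_prune tp.
by rewrite lE addnS tree_poly_after ?mulrA 1?[x k * _]mulrC //; lia.
Qed.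

Lemma tree_diff_no_cherry i t o a :
  (forall p, cherry t p -> (o + rank t p)%N <> i) ->
  (a <= i)%N -> tree_diff i t o a = 0.
Proof.
elim: t o a => [|l IHl r IHr] o a noc ai; first exact: subrr.
have [il|il] := boolP (o <= i < o + nleaves (Node l r))%N;
  last exact: tree_diff_out.
have [li|li] := leqP (o + nleaves l) i.
  have l0 := nleaves_gt0 l.
  rewrite tree_diff_right // big_nat big1 // => k ko.
  rewrite IHr ?mulr0 //; last by lia.
  by move=> p pr; have := noc (true :: p) pr; rewrite rank_right addnA.
have [lL|lN] := eqVneq l Leaf.
  have io : i = o by move: li; rewrite lL /nleaves /=; lia.
  rewrite lL io tree_diff_leaf -?io //.
  case: eqP => [rL|]; last by rewrite mulr0.
  case: (noc [::]); first by rewrite lL rL.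
  by rewrite rank_root addn0.
rewrite tree_diff_left //; last by lia.
rewrite big_nat big1 // => k ko.
rewrite IHl ?mulr0 ?mul0r //; last by lia.
move=> p pl; have := noc (false :: p) pl.
by rewrite rank_left // cherry_internals.
Qed.

End TreePoly.

(** * Iterated sums *)

Section IteratedSum.
Variables (A : comNzRingType) (N : nat).

Definition upd (T : eqType) (f : T -> nat) (v : T) (k : nat) : T -> nat :=
  fun w => if w == v then k else f w.

(** The sum of G over all functions that agree with f outside s and take
    values below N on s, as nested sums.  Being indexed by lists, it splits
    along [++] and is transported along injections, which sums over types of
    finite functions do not do directly. *)
Fixpoint isum (T : eqType) (s : seq T) (G : (T -> nat) -> A)
    (f : T -> nat) : A :=
  if s is v :: s' then \sum_(0 <= k < N) isum s' G (upd f v k) else G f.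

Lemma isum_ffun (T : finType) (s : seq T) (G : (T -> nat) -> A) f :
  uniq s -> (forall v, (f v < N)%N) ->
  \sum_(c : {ffun T -> 'I_N} | [forall v, (v \notin s) ==> (c v == f v :> nat)])
    G (fun v => c v) = isum s G f.
Proof.
elim: s f => [|v s IH] f /=.
  move=> _ fN; rewrite (big_pred1 [ffun v => Ordinal (fN v)]) => [|c].
    by congr G; apply: functional_extensionality => v; rewrite ffunE.
  apply/forallP/eqP => [cf|-> v]; last by rewrite ffunE.
  by apply/ffunP => v; rewrite ffunE; apply/val_inj/eqP/cf.
move=> /andP[vs us] fN.
rewrite (partition_big (fun c : {ffun T -> 'I_N} => c v) xpredT) //= big_mkord.
apply: eq_bigr => k _; rewrite -IH //; last first.
  by move=> w; rewrite /upd; case: (w == v).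
apply: eq_bigl => c; apply/andP/forallP => [[/forallP cf /eqP <-] w|cf].
  apply/implyP => ws; rewrite /upd; case: (eqVneq w v) => [-> //|wv].
  by have /implyP := cf w; apply; rewrite in_cons negb_or wv.
split; last by have /implyP/(_ vs) := cf v; rewrite /upd eqxx.
apply/forallP => w; apply/implyP; rewrite in_cons negb_or => /andP[wv ws].
by have /implyP/(_ ws) := cf w; rewrite /upd (negPf wv).
Qed.

Lemma eq_isum (T : eqType) (s : seq T) G G' (f : T -> nat) :
  (forall g, (forall v, v \notin s -> g v = f v) -> G g = G' g) ->
  isum s G f = isum s G' f.
Proof.
elim: s f => [|v s IH] f GG /=; first exact: GG.
apply: eq_bigr => k _; apply: IH => g gf; apply: GG => w.
by rewrite in_cons negb_or => /andP[wv ws]; rewrite gf // /upd (negPf wv).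
Qed.

Lemma isum_cat (T : eqType) (s1 s2 : seq T) G f :
  isum (s1 ++ s2) G f = isum s1 (isum s2 G) f.
Proof. by elim: s1 f => //= v s1 IH f; apply: eq_bigr => k _. Qed.

Lemma isum_map (S T : eqType) (h : S -> T) s G f : injective h ->
  isum (map h s) (fun g => G (g \o h)) f = isum s G (f \o h).
Proof.
move=> hI; elim: s f => //= v s IH f; apply: eq_bigr => k _; rewrite IH.
congr isum; apply: functional_extensionality => w.
by rewrite /upd /= (inj_eq hI).
Qed.

Lemma isum_scale (T : eqType) (s : seq T) (C G : (T -> nat) -> A) f :
  (forall v g k, v \in s -> C (upd g v k) = C g) ->
  isum s (fun g => C g * G g) f = C f * isum s G f.
Proof.
elim: s f => //= v s IH f CE; rewrite mulr_sumr; apply: eq_bigr => k _.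
rewrite IH => [|w g j ws]; first by rewrite CE ?mem_head.
by rewrite CE // in_cons ws orbT.
Qed.

(** V is the value of the second factor; asking for its invariance rather than
    for that of G2 avoids exchanging updates. *)
Lemma isum_mul (T : eqType) (s1 s2 : seq T) (G1 G2 V : (T -> nat) -> A) f :
  (forall v g k, v \in s2 -> G1 (upd g v k) = G1 g) ->
  (forall v g k, v \in s1 -> V (upd g v k) = V g) ->
  (forall g, isum s2 G2 g = V g) ->
  isum (s1 ++ s2) (fun g => G1 g * G2 g) f = isum s1 G1 f * V f.
Proof.
move=> G1E VE G2V; rewrite isum_cat mulrC -isum_scale //.
by apply: eq_isum => g _; rewrite isum_scale // G2V mulrC.
Qed.

Lemma upd_comp_out (S T : eqType) (h : S -> T) (g : T -> nat) v k :
  (forall w, h w != v) -> upd g v k \o h = g \o h.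
Proof.
move=> hv; apply: functional_extensionality => w.
by rewrite /upd /= (negPf (hv w)).
Qed.

End IteratedSum.

(** * Colorings as products over trees *)

Section Colorings.
Variables (A : comNzRingType) (x : nat -> A).

(** The monomial of f if f is a coloring in the sense of [tree_poly] (for the
    bounds j + 1), and 0 otherwise; the recursion matches the one of
    [tree_poly] term by term. *)
Fixpoint tree_weight (t : bintree) (o a : nat) (f : seq bool -> nat) : A :=
  if t is Node l r then
    if (a <= f [::] <= o)%N then
      x (f [::]) * tree_weight l o (f [::]) (f \o cons false)
      * tree_weight r (o + nleaves l) (f [::]).+1 (f \o cons true)
    else 0
  else 1.

Lemma isum_tree_weight N t o a f :
  (forall p, p \in internals t -> (o + rank t p < N)%N) ->
  isum N (internals t) (tree_weight t o a) f = tree_poly x succn t o a.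
Proof.
elim: t o a f => // l IHl r IHr o a f tN /=.
have oN : (o < N)%N by have := tN [::] (mem_head _ _); rewrite rank_root addn0.
set s := map _ _ ++ _.
have branch k : isum N s (tree_weight (Node l r) o a) (upd f [::] k) =
    (a <= k <= o)%N%:R *
    (x k * tree_poly x succn l o k * tree_poly x succn r (o + nleaves l) k.+1).
  (* Below the root, only functions g with value k at the root occur. *)
  pose W (g : seq bool -> nat) := tree_weight l o k (g \o cons false)
    * tree_weight r (o + nleaves l) k.+1 (g \o cons true).
  rewrite (@eq_isum _ _ _ _ _
    (fun g => (a <= k <= o)%N%:R * x k * W g)); last first.
    move=> g gs /=; have -> : g [::] = k.
      by rewrite gs // /s mem_cat; apply/orP => -[] /mapP[].
    by case: ifP => _; rewrite ?mul1r ?mul0r // /W mulrA.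
  rewrite isum_scale // -!mulrA; do 2 congr (_ * _).
  rewrite (@isum_mul _ _ _ _ _ _ _
    (fun=> tree_poly x succn r (o + nleaves l) k.+1)) //.
  - rewrite isum_map ?IHl // => [p pl|]; last exact: cons_inj.
    by rewrite -(rank_left r pl) tN // mem_internals_cons.
  - by move=> _ g j /mapP[p _ ->]; rewrite upd_comp_out.
  - move=> g; rewrite isum_map ?IHr // => [p pr|]; last exact: cons_inj.
    by rewrite -addnA -rank_right tN // mem_internals_cons.
under eq_bigr => k _ do rewrite branch.
rewrite [RHS](big_nat_widenl _ 0%N) // [RHS](big_nat_widen _ _ N) //.
rewrite [RHS]big_mkcond /=.

apply: eq_bigr => k _; rewrite ltnS.
by case: (_ && _); rewrite ?mul1r ?mul0r.
Qed.

Definition node_ok (t : bintree) (o : nat) (f : seq bool -> nat) p : bool :=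
  [&& (f p <= o + rank t p)%N,
      (rcons p false \in internals t) ==> (f p <= f (rcons p false))%N
    & (rcons p true \in internals t) ==> (f p < f (rcons p true))%N].

Lemma nil_internals t : ([::] \in internals t) = (t != Leaf).
Proof. by case: t. Qed.

Lemma tree_weightE t o a f :
  tree_weight t o a f =
  if ((t != Leaf) ==> (a <= f [::])%N) && all (node_ok t o f) (internals t)
  then \prod_(p <- internals t) x (f p) else 0.
Proof.
elim: t o a f => [|l IHl r IHr] o a f; first by rewrite /= big_nil.
rewrite [LHS]/= IHl IHr [internals _]/= big_cons big_cat !big_map /=.
have -> : node_ok (Node l r) o f [::] =
    [&& (f [::] <= o)%N, (l != Leaf) ==> (f [::] <= f [:: false])%N
      & (r != Leaf) ==> (f [::] < f [:: true])%N].
  by rewrite /node_ok rank_root addn0 !mem_internals_cons !nil_internals.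
rewrite all_cat !all_map.
have -> : all (preim (cons false) (node_ok (Node l r) o f)) (internals l) =
    all (node_ok l o (f \o cons false)) (internals l).
  apply: eq_in_all => p pl; rewrite /= /node_ok rank_left //.
  by rewrite !rcons_cons !mem_internals_cons.
have -> : all (preim (cons true) (node_ok (Node l r) o f)) (internals r) =
    all (node_ok r (o + nleaves l) (f \o cons true)) (internals r).
  apply: eq_all => p; rewrite /= /node_ok rank_right addnA.
  by rewrite !rcons_cons !mem_internals_cons.
case: (a <= _)%N; case: (_ <= o)%N => //=.
case: (_ ==> _) => /=; last by rewrite mulr0 mul0r.
case: (all _ _) => /=; last by rewrite andbF mulr0 mul0r.
case: (_ ==> _) => /=; last by rewrite mulr0.
by case: (all _ _) => /=; rewrite ?mulr0 // mulrA.
Qed.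

Lemma internals_uniq t : uniq (internals t).
Proof.
elim: t => //= l IHl r IHr.
rewrite cat_uniq !map_inj_uniq ?IHl ?IHr; try exact: cons_inj.
rewrite andbT /= mem_cat; apply/andP; split.
  by apply/orP => -[] /mapP[].
by apply/hasPn => _ /mapP[p _ ->]; apply/mapP => -[].
Qed.

Definition offset (F : forest) (k : nat) : nat := \sum_(j < k) nleaves (F j).

Lemma rhoE F v : rho F v = (offset F v.1 + rank (F v.1) v.2)%N.
Proof. by []. Qed.

Definition nodes (F : forest) (ks : seq nat) : seq (nat * seq bool) :=
  [seq (k, p) | k <- ks, p <- internals (F k)].

Lemma isum_nodes N F ks (W : nat -> (seq bool -> nat) -> A) f : uniq ks ->
  isum N (nodes F ks) (fun g => \prod_(k <- ks) W k (g \o pair k)) f =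
  \prod_(k <- ks) isum N (internals (F k)) (W k) (f \o pair k).
Proof.
elim: ks f => [|k ks IH] f /=; first by rewrite !big_nil.
move=> /andP[kks uks].
rewrite (@eq_isum _ _ _ _ _
  (fun g => W k (g \o pair k) * \prod_(j <- ks) W j (g \o pair j))); last first.
  by move=> g _; rewrite big_cons.
rewrite (@isum_mul _ _ _ _ _ _ _ (fun g =>
  \prod_(j <- ks) isum N (internals (F j)) (W j) (g \o pair j))).
- by rewrite big_cons (@isum_map _ _ _ _ (pair k)) // => p q [].
- move=> v g n /allpairsPdep[j [p [jks _ ->]]]; rewrite upd_comp_out // => q.
  by apply/eqP => -[kj _]; rewrite kj jks in kks.
- move=> _ g n /mapP[p _ ->]; apply: eq_big_seq => j jks.
  rewrite upd_comp_out // => q.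
  by apply/eqP => -[jk _]; rewrite -jk jks in kks.
- by move=> g; rewrite IH.
Qed.

Definition covers (F : forest) (K : nat) : Prop :=
  forall k, (K <= k)%N -> F k = Leaf.

Lemma nodes_perm F K : covers F K -> perm_eq (nodes F (iota 0 K)) (IN F).
Proof.
move=> FK; apply: uniq_perm; last 1 first.
- move=> [k p]; rewrite mem_IN /=.
  apply/allpairsPdep/idP => [[j [q [_ qj [-> ->]]]]|pk] //.
  exists k, p; split=> //; rewrite mem_iota ltnNge /= add0n.
  by apply: contraTN pk => /FK ->.
- apply: allpairs_uniq_dep => [|k _|]; first exact: iota_uniq.
    exact: internals_uniq.
  by move=> [k p] [j q] _ _ /= [-> ->].
- exact: fset_uniq.
Qed.

Lemma coloringE F K (g : nat * seq bool -> nat) : covers F K ->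
  coloring (fun v : IN F => g (val v)) =
  all (fun k => all (node_ok (F k) (offset F k) (g \o pair k))
    (internals (F k))) (iota 0 K).
Proof.
move=> FK; have childE (P : nat -> bool) w :
    [forall u : IN F, (val u == w) ==> P (g (val u))] =
    ((w \in IN F) ==> P (g w)).
  apply/forallP/implyP => [vP wF|vP u].
    by have /implyP/(_ (eqxx _)) := vP [` wF].
  by apply/implyP => /eqP uw; rewrite uw vP // -uw; exact: fsvalP.
pose at_node (v : IN F) :=
  node_ok (F (val v).1) (offset F (val v).1) (g \o pair (val v).1) (val v).2.
have okE (v : IN F) :
    [&& (g (val v) <= rho F (val v))%N,
        [forall w : IN F,
           (val w == lchild (val v)) ==> (g (val v) <= g (val w))%N]
      & [forall w : IN F,
           (val w == rchild (val v)) ==> (g (val v) < g (val w))%N]]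
    = at_node v.
  rewrite (childE (fun n => g (val v) <= n)%N).
  rewrite (childE (fun n => g (val v) < n)%N) /at_node.
  by rewrite !mem_IN rhoE; case: (val v).
apply/forallP/allP => [ok k _|ok v].
  apply/allP => p pk; have kpF : (k, p) \in IN F by rewrite mem_IN.
  by have := ok [` kpF]; rewrite okE.
have vF : (val v).2 \in internals (F (val v).1).
  by rewrite -mem_IN; exact: fsvalP.
rewrite okE; apply: (allP (ok (val v).1 _)) => //.
rewrite mem_iota ltnNge /= add0n.
by apply: contraTN vF => /FK ->.
Qed.

Lemma prod_if (I : Type) (r : seq I) (P : pred I) (E : I -> A) :
  \prod_(i <- r) (if P i then E i else 0) =
  if all P r then \prod_(i <- r) E i else 0.
Proof.
elim: r => [|i r IH] /=; first by rewrite !big_nil.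
by rewrite !big_cons IH; case: (P i); case: (all P r); rewrite ?mulr0 ?mul0r.
Qed.

(** The conditions of a coloring concern one tree at a time, so the sum over
    the colorings of the forest is a product of sums over its trees. *)
Lemma sum_colorings F K : covers F K ->
  \sum_(c : {ffun IN F -> 'I_(color_bound F)} | coloring (fun v => c v))
    \prod_(v : IN F) x (c v) =
  \prod_(k <- iota 0 K) tree_poly x succn (F k) (offset F k) 0.
Proof.
move=> FK.
pose G (c : IN F -> nat) := if coloring c then \prod_(v : IN F) x (c v) else 0.
pose s : seq (IN F) := pmap insub (nodes F (iota 0 K)).
have sE : map val s = nodes F (iota 0 K).
  rewrite /s pmap_filter; last exact: insubK.
  apply/all_filterP/allP => v; rewrite (perm_mem (nodes_perm FK)) => vF.
  by rewrite insubT.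
have s_uniq : uniq s.
  by rewrite -(map_inj_uniq val_inj) sE (perm_uniq (nodes_perm FK)) fset_uniq.
have s_full v : v \in s.
  rewrite -(mem_map val_inj) sE (perm_mem (nodes_perm FK)); exact: fsvalP.
rewrite big_mkcond /=.
transitivity (isum (color_bound F) s G (fun=> 0%N)).
  rewrite -isum_ffun //; apply: eq_bigl => c.
  by apply/esym/forallP => v; rewrite s_full.
rewrite -[LHS](@isum_map _ _ _ _ val s G (fun=> 0%N)); last exact: val_inj.
rewrite sE.
transitivity (isum (color_bound F) (nodes F (iota 0 K)) (fun g =>
   \prod_(k <- iota 0 K) tree_weight (F k) (offset F k) 0 (g \o pair k))
  (fun=> 0%N)).
  apply: eq_isum => g _.
  rewrite /G (coloringE _ FK) (eq_bigr _ (fun k _ => tree_weightE _ _ _ _)).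
  under [RHS]eq_bigr => k _ do rewrite leq0n implybT /=.
  rewrite prod_if; case: ifP => // _.
  rewrite -(@big_seq_fsetE _ _ _ _ (IN F) xpredT (fun v => x (g v))) /=.
  by rewrite -(perm_big _ (nodes_perm FK)) big_allpairs_dep.
rewrite (@isum_nodes _ _ _ (fun k => tree_weight (F k) (offset F k) 0));
  last exact: iota_uniq.
apply: eq_bigr => k _.
apply: isum_tree_weight => p pk.
have kpF : (k, p) \in IN F by rewrite mem_IN.
by rewrite ltnS (leq_bigmax [` kpF]).
Qed.

End Colorings.

(** * Trimming a forest *)

Section ForestDifference.
Variables (A : comNzRingType) (x : nat -> A).

Lemma terminalE (F : forest) v : terminal F v = cherry (F v.1) v.2.
Proof. by rewrite /terminal mem_IN cherryE. Qed.

Lemma LTerP (F : forest) i :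
  reflect (exists k p, cherry (F k) p /\ (offset F k + rank (F k) p)%N = i)
          (i \in LTer F).
Proof.
apply: (iffP idP) => [/imfsetP[[k p] /= vF ->]|[k [p [kp <-]]]].
  by exists k, p; move: vF; rewrite inE terminalE => /andP[_ ->].
apply/imfsetP; exists (k, p) => //; rewrite inE /= terminalE mem_IN kp andbT.
exact: cherry_internals.
Qed.

Lemma trimP (F : forest) i : i \in LTer F -> exists k p,
  [/\ cherry (F k) p, (offset F k + rank (F k) p)%N = i
    & forall j, trim F i j = if j == k then prune (F k) p else F j].
Proof.
move=> /LTerP[k [p [kp rk]]]; rewrite /trim.
case: pickP => [v /andP[tv /eqP rv]|none].
  exists (val v).1, (val v).2; rewrite -terminalE -rhoE; split=> // j.
  by rewrite fsfun_withE.
have kpF : (k, p) \in IN F by rewrite mem_IN cherry_internals.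
by have := none [` kpF]; rewrite /= terminalE kp rhoE rk eqxx.
Qed.

Lemma exists_covers (F : forest) : exists K, covers F K.
Proof.
exists (\max_(k <- finsupp F) k).+1 => k Kk.
apply: fsfun_dflt; apply: contraL Kk => kF.
by rewrite -ltnNge ltnS; exact: (leq_bigmax_seq _ kF).
Qed.

Lemma offset_le (F : forest) j k :
  (j < k)%N -> (offset F j + nleaves (F j) <= offset F k)%N.
Proof.
rewrite /offset -(big_mkord xpredT (fun j => nleaves (F j))).
rewrite -(big_mkord xpredT (fun j => nleaves (F j))) => jk.
by rewrite (big_cat_nat (leq0n j.+1) jk) /= big_nat_recr //= leq_addr.
Qed.

Lemma offset_prune (F F' : forest) k p j : cherry (F k) p ->
  (forall j, F' j = if j == k then prune (F k) p else F j) ->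
  offset F j = (offset F' j + (k < j))%N.
Proof.
move=> kp F'E; elim: j => [|j IH]; first by rewrite /offset !big_ord0.
rewrite /offset !big_ord_recr /= -!/(offset _ _) IH F'E.
case: (eqVneq j k) => [->|jk]; last by lia.
by rewrite (nleaves_prune kp); lia.
Qed.

Definition forest_sum F : A :=
  \sum_(c : {ffun IN F -> 'I_(color_bound F)} | coloring (fun v => c v))
    \prod_(v : IN F) x (c v).

Definition reindexes i (f : {rmorphism A -> A}) := forall j, f (x j) =
  if (j < i)%N then x j else if j == i then 0 else x j.-1.

Lemma forest_sum_R (F : forest) K i f : covers F K -> reindexes i f ->
  f (forest_sum F) =
  \prod_(k <- iota 0 K) tree_poly x (bound i) (F k) (offset F k) 0.
Proof.
move=> FK fx; rewrite /forest_sum (sum_colorings x FK) rmorph_prod /=.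
by apply: eq_bigr => k _; rewrite (tree_poly_R _ _ _ _ fx).
Qed.

(** Only the factor of the tree containing the leaf i changes.  If that leaf
    starts a cherry, the factors before it are insensitive to R_i and R_(i+1),
    and the factors after it are those of the trimmed forest, where their
    leaves are renumbered. *)
Lemma forest_sum_diff (F : forest) i f1 f0 :
  reindexes i.+1 f1 -> reindexes i f0 ->
  f1 (forest_sum F) - f0 (forest_sum F) =
  x i * (if i \in LTer F then forest_sum (trim F i) else 0).
Proof.
move=> f1x f0x; have [K FK] := exists_covers F.
rewrite (forest_sum_R FK f1x) (forest_sum_R FK f0x); case: ifPn => [iF|iF].
  have [k [p [kp rk F'E]]] := trimP iF; set F' := trim F i in F'E *.
  have kK : (k < K)%N.
    by rewrite ltnNge; apply: contraTN kp => /FK ->; case: (p).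
  have F'K : covers F' K.
    move=> j Kj; rewrite F'E (FK j Kj); case: eqP => // jk.
    by move: kK; rewrite -jk ltnNge Kj.
  rewrite /forest_sum (sum_colorings x F'K).
  have kI : k \in iota 0 K by rewrite mem_iota.
  rewrite !(bigD1_seq k kI (iota_uniq _ _)) /=.
  have rkk := rank_lt (cherry_internals kp).
  have offE := offset_prune _ kp F'E.
  rewrite F'E eqxx mulrA.
  have -> : offset F' k = offset F k by rewrite offE ltnn addn0.
  have sides j : j != k -> (offset F j + nleaves (F j) <= i /\ j < k \/
      (i < offset F j) /\ k < j)%N.
    rewrite neq_ltn => /orP[jk|kj]; [left|right].
      by have := offset_le F jk; lia.
    by have := offset_le F kj; lia.
  have -> : \prod_(j <- iota 0 K | j != k)
        tree_poly x (bound i) (F j) (offset F j) 0 =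
      \prod_(j <- iota 0 K | j != k)
        tree_poly x (bound i.+1) (F j) (offset F j) 0.
    by apply: eq_bigr => j /sides jk; rewrite tree_poly_out //; lia.
  have -> : \prod_(j <- iota 0 K | j != k)
        tree_poly x (bound i.+1) (F j) (offset F j) 0 =
      \prod_(j <- iota 0 K | j != k)
        tree_poly x succn (F' j) (offset F' j) 0.
    apply: eq_bigr => j jk; rewrite F'E (negPf jk).
    case: (sides j jk) => -[ij jk'].
      rewrite offE ltnNge (ltnW jk') addn0 in ij *.
      by rewrite tree_poly_before //; lia.
    by rewrite offE jk' addn1 in ij *; rewrite tree_poly_after.
  by rewrite -mulrBl -(tree_diff_cherry x kp rk (leq0n i)).
rewrite mulr0; apply/eqP; rewrite subr_eq0; apply/eqP.
apply: eq_bigr => k _; apply/eqP; rewrite -subr_eq0; apply/eqP.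
apply: (tree_diff_no_cherry x) => // p kp kpi.
by case/LTerP: iF; exists k, p.
Qed.

End ForestDifference.

(** * The characterization *)

Definition PolRing : comNzRingType := Pol.

Lemma R_reindexes i :
  reindexes (A := PolRing) x_ i (subst (fun j =>
    if (j < i)%N then x_ j else if j == i then 0 else x_ j.-1)).
Proof. by move=> j; exact: subst_x. Qed.

Lemma T_forest_poly (F : forest) i :
  T_ i (forest_poly F) = if i \in LTer F then forest_poly (trim F i) else 0.
Proof.
apply: T_eq; exact: (forest_sum_diff F (R_reindexes i.+1) (R_reindexes i)).
Qed.

Lemma forest_poly_homogeneous F : homogeneous (forest_poly F).
Proof. by apply: homogeneous_sum => c _ m; exact: mdeg_prod_x. Qed.

Lemma forest_poly_empty : forest_poly empty_forest = 1.
Proof.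
have E0 : covers empty_forest 0 by move=> k _; exact: fsfun0E.
by apply: (etrans (sum_colorings (x_ : nat -> PolRing) E0)); rewrite big_nil.
Qed.

Lemma exists_LTer (F : forest) : F <> empty_forest -> exists i, i \in LTer F.
Proof.
move=> F0; have [k kF] : exists k, k \in finsupp F.
  apply/fset0Pn; apply: contra_notN F0 => /eqP F0; apply/fsfunP => k.
  by rewrite fsfun0E fsfun_dflt // F0.
have [p kp] : exists p, cherry (F k) p.
  by apply: exists_cherry; rewrite -mem_finsupp.
by exists (offset F k + rank (F k) p)%N; apply/LTerP; exists k, p.
Qed.

Lemma trim_proper (F : forest) i : i \in LTer F -> IN (trim F i) `<` IN F.
Proof.
move=> /trimP[k [p [kp _ tE]]]; have pk := cherry_internals kp.
have [sub pN] := internals_prune pk; rewrite fproperE; apply/andP; split.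
  apply/fsubsetP => -[j q]; rewrite !mem_IN /= tE.
  case: eqP => // ->; exact: sub.
by apply/fsubsetPn; exists (k, p); rewrite mem_IN //= tE eqxx.
Qed.

(** The induction carries along that P_F is not zero, which is what shows that
    H_F is not constant one step later. *)
Lemma characterization_unique (H : forest -> Pol) F :
  characterization H -> H F = forest_poly F /\ forest_poly F <> 0.
Proof.
case=> H0 Hh HT.
have [n Fn] := ubnP #|` IN F|; elim: n F Fn => // n IH F.
rewrite ltnS => Fn.
have [F0|F0] := eqVneq F empty_forest.
  rewrite F0 H0 forest_poly_empty; split=> //; exact/eqP/oner_neq0.
have {}IH i : i \in LTer F -> H (trim F i) = forest_poly (trim F i) /\
    forest_poly (trim F i) <> 0.
  move=> iF; apply: IH; apply: leq_trans Fn.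
  exact/fproper_ltn_card/trim_proper.
have [i iF] := exists_LTer (elimN eqP F0).
have [HE P0] := IH i iF.
have TP : T_ i (forest_poly F) <> 0 by rewrite T_forest_poly iF.
have TH : T_ i (H F) <> 0 by rewrite HT iF HE.
split; last by move=> PF; apply: TP; rewrite PF; apply: T_eq0; rewrite !R_0.
apply/eqP; rewrite -subr_eq0; apply/eqP; rewrite [LHS]T_eq0_const.
  rewrite at0_B (at0_eq0 (Hh F) TH).
  by rewrite (at0_eq0 (forest_poly_homogeneous F) TP) subrr.
move=> j; rewrite T_B HT T_forest_poly.
by case: ifP => [/IH[-> _]|_]; rewrite subrr.
Qed.

Theorem theorem6p4 :
  characterization forest_poly /\
  (forall H : forest -> Pol, characterization H ->
     forall F : forest, H F = forest_poly F).
Proof.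
split; last by move=> H Hc F; case: (characterization_unique F Hc).
split; [exact: forest_poly_empty | exact: forest_poly_homogeneous|].
exact: T_forest_poly.
Qed.
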